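(* Let $G_{\mathrm{ph}}$ be any physical graph and let $D$ be a demand matrix with $|D|=1$. For any source-destination pair $s,e$ with $D_{s,e}=1$, for both the modified greedy and the local best effort routing algorithms, the expected waiting time is upper bounded by $$O\left(P^{-\mathrm{diam}_{G_{\mathrm{ph}}}}\right)\ \text{ in the on-demand model},\qquad O\left(d_{\mathrm{th}}\,\mathrm{diam}_{G_{\mathrm{ph}}}\right)\ \text{ in the continuous model},$$ where $P=1-(1-P_0)^{T_{\mathrm{th}}}$ is the probability of creating an entangled link between two physically neighbouring nodes within $T_{\mathrm{th}}$ time steps.
   Context: $G_{\mathrm{ph}}=(V,E_{\mathrm{ph}})$ is a finite connected graph; $\mathrm{dist}_{G_{\mathrm{ph}}}$ is hop distance and $\mathrm{diam}_{G_{\mathrm{ph}}}$ its diameter. $D$ is the demand matrix: $D_{i,j}$ is the number of entangled links requested between $i$ and $j$; $|D|$ is the number of nonzero entries. Time is discrete; one time step is the communication time across one physical edge, so sending a classical message between $u$ and $v$ takes $\mathrm{dist}_{G_{\mathrm{ph}}}(u,v)$ steps. Entanglement generation. In each time step an attempt to create an elementary link across a physical edge succeeds (heralded) with probability $P_0\in(0,1]$, independently. A link can be stored for at most $T_{\mathrm{th}}$ time steps. An entangled link between two nodes joined by a physical path of $d$ edges is created if all $d$ elementary links are created within a window of $T_{\mathrm{th}}$ time steps (classical communication for this is neglected), which happens with probability at least $P^d$; otherwise everything is discarded and a new window begins. Entanglement swapping is deterministic and takes no time. $T_{\mathrm{th}}$ and $P_0$ are fixed parameters, so the implied constant in the on-demand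 bound may depend on $T_{\mathrm{th}}$. On-demand model: no pre-shared links; upon a demand the source computes a shortest path to the destination in $G_{\mathrm{ph}}$, and the entangled link between source and destination is generated along this path by repeated windows of $T_{\mathrm{th}}$ time steps: if the path has $d$ edges, a window succeeds when all $d$ elementary links along the path are created within it (probability at least $P^d$), after which the intermediate nodes perform the swaps; otherwise everything is discarded and a new window begins. Continuous model: there is an undirected virtual graph $\mathcal G=(V,\mathcal E)$ containing all physical edges and additional virtual edges joining nodes at physical distance at most $d_{\mathrm{th}}$; each edge carries $cap\ge1$ pre-shared entangled links, available when the demand arrives. The waiting time is the time to discover the path hop by hop plus the time to inform the nodes on the path to perform the swaps. $\mathcal G(u,v)$ is the number of available links between $u,v$. Both algorithms start at $u_{\mathrm{curr}}=s$ and stop at $e$. - Modified greedy: let $u$ be the $\mathcal G$-neighbour of $u_{\mathrm{curr}}$ minimising $\mathrm{dist}_{G_{\mathrm{ph}}}(\cdot,e)$. If $\mathcal G(u,u_{\mathrm{curr}})<D_{s,e}$ and $\mathrm{dist}_{G_{\mathrm{ph}}}(u_{\mathrm{curr}},e)<\mathrm{dist}_{G_{\mathrm{ph}}}(u_{\mathrm{curr}},u)+\mathrm{dist}_{G_{\mathrm{ph}}}(u,e)$, replace $u$ by the physical neighbour of $u_{\mathrm{curr}}$ closest to $e$. The next node is $u$. - Local best effort: let $u$ minimise $\mathrm{dist}_{G_{\mathrm{ph}}}(\cdot,e)$ among the $\mathcal G$-neighbours $v$ of $u_{\mathrm{curr}}$ with $\mathcal G(v,u_{\mathrm{curr}})\ge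 D_{s,e}$. If no such $u$ exists or $u$ is not strictly closer to $e$ than $u_{\mathrm{curr}}$, take the physical neighbour of $u_{\mathrm{curr}}$ closest to $e$. The next node is $u$. *)

(* Defs.v *)
From HB Require Import structures.
From mathcomp Require Import all_boot all_order all_algebra.
From mathcomp Require Import all_classical all_reals all_analysis.

Set Implicit Arguments.
Unset Strict Implicit.
Unset Printing Implicit Defensive.

Import Order.TTheory GRing.Theory Num.Theory.

Local Open Scope nat_scope.

Section Graphs.
Variable V : finType.
Implicit Types (g : rel V) (u v : V).

Definition simple_graph g : Prop := symmetric g /\ irreflexive g.

Definition connected_graph g : Prop := forall u v, connect g u v.

(* The least length of a walk from u to v.  A shortest walk has fewer than #|V|
   edges, so in a connected graph the search always succeeds; the value for
   disconnected vertices would be #|V|. *)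
Definition hopdist g u v : nat :=
  find (fun n => [exists p : n.-tuple V, path g u p && (last u p == v)])
       (iota 0 #|V|).

Definition diameter g : nat := \max_(u : V) \max_(v : V) hopdist g u v.

(* The vertices of the path are u :: p. *)
Definition shortest_path g u v (p : seq V) : Prop :=
  [/\ path g u p, last u p = v & size p = hopdist g u v].

Definition is_edge g (f : {set V}) : bool :=
  [exists u, exists v, g u v && (f == [set u; v])].

Definition path_edges u (p : seq V) : seq {set V} :=
  pairmap (fun a b => [set a; b]) u p.

Definition nb_demands (D : V -> V -> nat) : nat :=
  #|[set ij : V * V | D ij.1 ij.2 != 0]|.

End Graphs.

Definition first_time (Q : pred nat) : option nat :=
  if pselect (exists n, Q n) is left h then Some (ex_minn h) else None.

Section OnDemand.
Variables (d : measure_display) (Omega : measurableType d) (R : realType).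
Variable Pr : probability Omega R.

Local Open Scope classical_set_scope.

Definition mutually_independent (I : choiceType) (J : pred I)
    (E : I -> set Omega) : Prop :=
  forall F : seq I, uniq F -> all J F ->
    Pr (\bigcap_(i in [set` F]) E i) = (\prod_(i <- F) Pr (E i))%E.

Variables (V : finType) (gph : rel V).

(* A t f w: the attempt on the undirected physical edge f in time step t
   succeeds. *)
Definition attempts (P0 : R) (A : nat -> {set V} -> Omega -> bool) : Prop :=
  [/\ forall t f, is_edge gph f -> measurable [set w | A t f w],
      forall t f, is_edge gph f -> Pr [set w | A t f w] = P0%:E
    & mutually_independent (fun tf : nat * {set V} => is_edge gph tf.2)
        (fun tf => [set w | A tf.1 tf.2 w])].

(* Window k consists of the time steps k * Tth, ..., k * Tth + Tth - 1. *)
Definition window_succeeds (Tth : nat) (A : nat -> {set V} -> Omega -> bool)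
    (s : V) (p : seq V) (w : Omega) (k : nat) : bool :=
  all (fun f => [exists i : 'I_Tth, A (k * Tth + i) f w]) (path_edges s p).

(* A successful window is counted in full. *)
Definition on_demand_wait (Tth : nat) (A : nat -> {set V} -> Omega -> bool)
    (s : V) (p : seq V) (w : Omega) : \bar R :=
  if first_time (window_succeeds Tth A s p w) is Some k
  then ((k.+1 * Tth)%:R)%:E else +oo%E.

End OnDemand.

Inductive routing := ModifiedGreedy | LocalBestEffort.

Section Continuous.
Variables (V : finType) (gph : rel V).

Definition virtual_graph (dth : nat) (Ev : rel V) : Prop :=
  [/\ symmetric Ev, irreflexive Ev, subrel gph Ev
    & forall u v, Ev u v -> gph u v || (hopdist gph u v <= dth)].

Definition links (cap : nat) (Ev : rel V) (u v : V) : nat :=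
  if Ev u v then cap else 0.

(* Ties are not broken: every minimiser qualifies. *)
Definition closest (N : pred V) (e v : V) : bool :=
  N v && [forall w, N w ==> (hopdist gph v e <= hopdist gph w e)].

Definition greedy_step (G : V -> V -> nat) (Ev : rel V) (Dse : nat)
    (e ucurr next : V) : bool :=
  [exists u, closest (Ev ucurr) e u &&
     (if (G u ucurr < Dse) &&
         (hopdist gph ucurr e < hopdist gph ucurr u + hopdist gph u e)
      then closest (gph ucurr) e next
      else next == u)].

(* All minimisers are at the same distance from e, so the test does not depend
   on the choice of u. *)
Definition best_effort_step (G : V -> V -> nat) (Ev : rel V) (Dse : nat)
    (e ucurr next : V) : bool :=
  let N := [pred v | Ev ucurr v && (Dse <= G v ucurr)] in
  if [exists u, closest N e u && (hopdist gph u e < hopdist gph ucurr e)]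
  then closest N e next
  else closest (gph ucurr) e next.

Definition routing_step (alg : routing) :=
  match alg with
  | ModifiedGreedy => greedy_step
  | LocalBestEffort => best_effort_step
  end.

(* x k is the current node after k hops.  The run stops at e: the values of x
   after the first visit to e are irrelevant. *)
Definition routing_run (alg : routing) (cap : nat) (Ev : rel V) (Dse : nat)
    (s e : V) (x : nat -> V) : Prop :=
  x 0 = s /\
  forall k, x k != e ->
    routing_step alg (links cap Ev) Ev Dse e (x k) (x k.+1).

(* Discovery forwards a message from each node of the path to the next one.
   The instruction to swap is then relayed back along the path from e; by the
   triangle inequality this takes at least as long as messages sent by e
   directly to every node of the path. A run that misses e waits forever. *)
Definition continuous_wait (R : realType) (e : V) (x : nat -> V) : \bar R :=
  if first_time (fun k => x k == e) is Some n
  then ((\sum_(0 <= k < n) hopdist gph (x k) (x k.+1) +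
         \sum_(0 <= k < n) hopdist gph (x k.+1) (x k))%:R)%:E
  else +oo%E.

Section Random.
Variables (d : measure_display) (Omega : measurableType d).
Local Open Scope classical_set_scope.

(* The virtual graph (and the tie-breaking in runs) may be random; the case of
   a fixed graph is that of constant functions. *)
Definition random_virtual_graph (dth : nat) (Ev : Omega -> rel V) : Prop :=
  (forall w, virtual_graph dth (Ev w)) /\
  (forall u v, measurable [set w | Ev w u v]).

Definition random_run (alg : routing) (cap : nat) (Ev : Omega -> rel V)
    (Dse : nat) (s e : V) (x : Omega -> nat -> V) : Prop :=
  (forall w, routing_run alg cap (Ev w) Dse s e (x w)) /\
  (forall k v, measurable [set w | x w k = v]).

End Random.
End Continuous.

(* Main.v *)
Require Import Defs.
From mathcomp Require Import all_boot all_order all_algebra.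
From mathcomp Require Import all_classical all_reals all_analysis.
From mathcomp Require Import measurable_realfun.
Import Order.TTheory GRing.Theory Num.Theory.
Local Open Scope ring_scope.

Set Implicit Arguments.
Unset Strict Implicit.
Unset Printing Implicit Defensive.

(* On demand: distinct windows are independent and each succeeds with
   probability q = P ^ m, where m <= diam is the number of edges of the path, so
   the probability that the first n windows fail is (1 - q) ^ n.  The waiting
   time is Tth times the number of n such that the first n windows fail, hence
   its expectation is Tth / q.
   Continuous: every step of either algorithm strictly decreases the distance
   to e, because a physical neighbour closer to e is always available.  So there
   are at most diam steps, each of physical length at most dth, and the path is
   traversed twice. *)

Lemma first_timeP (Q : pred nat) :
  match first_time Q with
  | Some n => Q n /\ forall m, (m < n)%N -> ~~ Q m
  | None => forall n, ~~ Q n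
  end.
Proof.
rewrite /first_time; case: pselect => [exQ|nexQ].
  case: ex_minnP => n Qn min_n; split=> // m lt_mn.
  by apply/negP => /min_n; rewrite leqNgt lt_mn.
by move=> n; apply/negP => Qn; apply: nexQ; exists n.
Qed.

(** * Hop distance, and the decrease of the distance to the destination along a run *)

Section HopDistance.
Local Open Scope nat_scope.
Variables (V : finType) (g : rel V).
Implicit Types (u v e : V) (p : seq V).

Lemma hopdist_le u v p : path g u p -> last u p = v -> hopdist g u v <= size p.
Proof.
move=> gp lastp; rewrite leqNgt; apply/negP => lt_p.
have lt_pV : size p < #|V|.
  by apply: leq_trans lt_p _; rewrite -[X in _ <= X](size_iota 0) find_size.
have := before_find 0 lt_p; rewrite nth_iota // add0n => /idP; apply.
by apply/existsP; exists (in_tuple p); rewrite /= gp lastp /=.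
Qed.

Lemma hopdist_le1 u v : g u v -> hopdist g u v <= 1.
Proof. by move=> guv; apply: (@hopdist_le _ _ [:: v]); rewrite //= guv. Qed.

Lemma hopdist_diameter u v : hopdist g u v <= diameter g.
Proof.
apply: leq_trans (leq_bigmax (F := fun u => \max_v hopdist g u v) u).
exact: (leq_bigmax (F := hopdist g u)).
Qed.

Hypothesis g_conn : connected_graph g.

(** Removing the loops from a walk leaves fewer than [#|V|] edges, so the search in [hopdist]
    succeeds before its default value and the length found is attained. *)
Lemma exists_shortest_path u v : exists p, shortest_path g u v p.
Proof.
have /connectP[p0 gp0 ->] := g_conn u v.
case: (shortenP gp0) => p gp up _.
have lt_p : size p < #|V|.
  by have := max_card (mem (u :: p)); rewrite (card_uniqP up).
pose Q n := [exists q : n.-tuple V, path g u q && (last u q == last u p)].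
have hasQ : has Q (iota 0 #|V|).
  apply/hasP; exists (size p); first by rewrite mem_iota.
  by apply/existsP; exists (in_tuple p); rewrite /= gp eqxx.
have := nth_find 0 hasQ; rewrite -/(hopdist g u (last u p)).
rewrite nth_iota ?add0n; last by apply: leq_ltn_trans lt_p; exact: hopdist_le.
case/existsP => q /andP[gq /eqP lastq].
by exists q; split=> //; rewrite size_tuple.
Qed.

Lemma exists_closer_neighbour u e :
  u != e -> exists2 v, g u v & hopdist g v e < hopdist g u e.
Proof.
have [[|v p] [/= gp lastp sizep]] := exists_shortest_path u e.
  by rewrite lastp eqxx.
move=> _; case/andP: gp => guv gp; exists v => //.
by rewrite -sizep ltnS hopdist_le.
Qed.

Lemma closest_decreases (N : pred V) u e v : u != e -> {subset g u <= N} ->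
  closest g N e v -> hopdist g v e < hopdist g u e.
Proof.
move=> /exists_closer_neighbour[w guw lt_w] gN /andP[_ /forallP/(_ w)].
by move/implyP/(_ (gN w guw)) => le_v; apply: leq_ltn_trans lt_w.
Qed.

(** The decrease bounds the number of hops; [Ev u v] is recorded because it bounds the physical
    length of each hop. *)
Lemma routing_step_decreases alg G dth (Ev : rel V) Dse e u v :
  virtual_graph g dth Ev -> u != e -> routing_step g alg G Ev Dse e u v ->
  Ev u v /\ hopdist g v e < hopdist g u e.
Proof.
move=> [_ _ gEv _] neq_ue.
have phys w : closest g (g u) e w -> Ev u w /\ hopdist g w e < hopdist g u e.
  by move=> clw; split;
    [case/andP: clw => /gEv | exact: (@closest_decreases (g u))].
case: alg => /=.
  case/existsP => w /andP[clw]; case: ifP => _; first exact: phys.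
  move/eqP->; split; first by case/andP: clw.
  by apply: closest_decreases clw => // z; exact: gEv.
(* The capacity filter may discard physical neighbours, so [closest_decreases] does not apply to the
   filtered set; the decrease comes from the test made by the algorithm itself. *)
rewrite /best_effort_step; case: ifP => [|_]; last exact: phys.
case/existsP => w /andP[/andP[Nw _] lt_w] /andP[/andP[Euv _]].
by move=> /forallP/(_ w)/implyP/(_ Nw) le_vw; split=> //; apply: leq_ltn_trans lt_w.
Qed.

Lemma continuous_wait_le (R : realType) alg dth cap (Ev : rel V) Dse s e x :
  0 < dth -> virtual_graph g dth Ev ->
  routing_run g alg cap Ev Dse s e x ->
  (continuous_wait g R e x <= (2 * dth%:R * (diameter g)%:R)%:E)%E.
Proof.
move=> dth_gt0 vEv [x0 step].
have stepE k : x k != e ->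
    Ev (x k) (x k.+1) /\ hopdist g (x k.+1) e < hopdist g (x k) e.
  by move=> ne; exact: routing_step_decreases vEv ne (step k ne).
(* A physical edge has length at most 1, hence at most [dth] by [dth_gt0]. *)
have hop_le u v : Ev u v -> hopdist g u v <= dth.
  have [_ _ _ Ed] := vEv; move=> /Ed/orP[/hopdist_le1|//] /leq_trans; exact.
(* Each hop before the first visit to [e] costs at least one unit of distance. This bounds the
   number of hops and also excludes a run that never reaches [e]. *)
have progress k : (forall j, j < k -> x j != e) ->
    hopdist g (x k) e + k <= hopdist g s e.
  elim: k => [|k IHk] ne; first by rewrite x0 addn0.
  apply: leq_trans (IHk _); last by move=> j /ltnW/ne.
  by rewrite addnS -addSn leq_add2r; have [] := stepE k (ne k (ltnSn k)).
rewrite /continuous_wait; case: first_time (first_timeP (fun k => x k == e)).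
  move=> n [_ ne]; rewrite lee_fin -!natrM ler_nat -mulnA mul2n -addnn.
  have le_n : n <= diameter g.
    apply: leq_trans (hopdist_diameter s e).
    by apply: leq_trans (progress n ne); exact: leq_addl.
  (* Used twice: for the discovery and for the swap instructions travelling back. *)
  have bound (h : nat -> nat) : (forall k, k < n -> h k <= dth) ->
      \sum_(0 <= k < n) h k <= dth * diameter g.
    move=> le_h; apply: (@leq_trans (dth * n)); last by rewrite leq_mul2l le_n orbT.
    rewrite -[n in dth * n]subn0 mulnC -sum_nat_const_nat !big_mkord.
    by apply: leq_sum => i _; apply: le_h.
  have [Esym _ _ _] := vEv.
  by apply: leq_add; apply: bound => k /ne/stepE[Ek _]; apply: hop_le => //; rewrite Esym.
move=> ne; have := progress (hopdist g s e).+1 (fun j _ => ne j).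
by rewrite addnS ltnNge leq_addl.
Qed.

End HopDistance.

(** * Expectation of a first success time *)

Section Integral.
Local Open Scope ereal_scope.
Context d (Omega : measurableType d) (R : realType).

(* Unlike [ge0_le_integral], requires no measurability. *)
Lemma ge0_le_integralT (mu : {measure set Omega -> \bar R})
    (f h : Omega -> \bar R) :
  (forall w, 0 <= f w) -> (forall w, f w <= h w) ->
  \int[mu]_w f w <= \int[mu]_w h w.
Proof.
move=> f0 fh; have h0 w := le_trans (f0 w) (fh w).
rewrite !ge0_integralTE//; apply: ereal_sup_le => _ [k kf <-].
by exists k => // w; apply: le_trans (fh w).
Qed.

(** Tail-sum argument: the integrand is dominated by [c] times the sum over [n] of the indicators
    that the first [n] trials fail, and this series integrates term by term to a geometric one. *)
Lemma expected_first_time_le (Pr : probability Omega R) (Q : Omega -> pred nat)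
    (c q : R) :
  (0 < c)%R -> (0 < q)%R ->  (q <= 1)%R ->
  (forall n, measurable [set w | all (predC (Q w)) (iota 0 n)]%classic) ->
  (forall n, Pr [set w | all (predC (Q w)) (iota 0 n)]%classic =
    ((1 - q) ^+ n)%:E) ->
  \int[Pr]_w (if first_time (Q w) is Some k then (k.+1%:R * c)%:E else +oo)
    <= (c / q)%:E.
Proof.
move=> c0 q0 q1.
pose F n := [set w | all (predC (Q w)) (iota 0 n)]%classic.
move=> mF; have {}mF n : measurable (F n) := mF n.
move=> PrF; have {}PrF n : Pr (F n) = ((1 - q) ^+ n)%:E := PrF n.
pose g n w : \bar R := (c * \1_(F n) w)%:E.
have g0 n w : 0 <= g n w by rewrite lee_fin mulr_ge0 ?(ltW c0) // indicE ler0n.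
(* The shift in [m.+1 < N] allows [N = k.+1] when the first success is at [k]: the term [n = 0]
   always counts. Without any success, every [N] is allowed. *)
have sum_g w N : (forall m, (m.+1 < N)%N -> ~~ Q w m) ->
    (N%:R * c)%:E <= \sum_(0 <= n <oo) g n w.
  move=> nQ; apply: le_trans (nneseries_lim_ge N _); last by move=> n _ _; exact: g0.
  rewrite sumEFin lee_fin big_mkord mulr_natl.
  rewrite (eq_bigr (fun=> c)) ?sumr_const ?card_ord // => n _.
  rewrite indicE mem_set ?mulr1 //=; apply/allP => m; rewrite mem_iota add0n /=.
  by move=> lt_mn; apply: nQ; apply: leq_ltn_trans lt_mn _.
apply: (@le_trans _ _ (\int[Pr]_w \sum_(0 <= n <oo) g n w)).
  apply: ge0_le_integralT => w.
    by case: first_time => // k; rewrite lee_fin mulr_ge0 // ltW.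
  case: first_time (first_timeP (Q w)) => [k [_ nQ]|nQ]; first exact: sum_g.
  suff -> : \sum_(0 <= n <oo) g n w = +oo by [].
  (* If no trial succeeds, the partial sums [N * c] exceed every real [A]. *)
  apply/eqyP => A A0; apply: le_trans (sum_g w (Num.bound (A / c)) _) => //.
  rewrite lee_fin -ler_pdivrMr // ltW //.
  by apply: archi_boundP; rewrite divr_ge0 ?ltW.
rewrite integral_nneseries //; last first.
  by move=> n; apply/measurable_EFinP; exact: measurable_funM.
have int_g n : \int[Pr]_w g n w = (c * (1 - q) ^+ n)%:E.
  rewrite (integralZl_indic _ (fun=> F n)) //; last first.
    by move=> c_lt0; have := lt_trans c_lt0 c0; rewrite ltxx.
  by rewrite integral_indic // setIT EFinM; congr (_ * _); exact: PrF.
rewrite (eq_eseriesr (fun n _ => int_g n)).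
have r0 : (0 <= 1 - q)%R by rewrite subr_ge0.
apply: lime_le; first by apply: is_cvg_nneseries => n _ _; rewrite lee_fin mulr_ge0 ?exprn_ge0 // ltW.
apply: nearW => n; rewrite sumEFin lee_fin -mulr_sumr ler_pM2l //.
rewrite -[leLHS](mulKf (lt0r_neq0 q0)) ler_piMr ?invr_ge0 ?(ltW q0) //.
(* the geometric sum: [q * \sum_(i < n) (1 - q) ^+ i = 1 - (1 - q) ^+ n] *)
have := subrX1 (1 - q)%R n; rewrite addrAC subrr add0r mulNr => /eqP.
by rewrite -eqr_oppLR opprB big_mkord => /eqP <-; rewrite gerBl exprn_ge0.
Qed.
End Integral.

(** * Independence of events built from disjoint subfamilies *)

Section Independence.
Local Open Scope classical_set_scope.
Context d (Omega : measurableType d) (R : realType) (Pr : probability Omega R).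
Context (I : choiceType) (E : I -> set Omega).
Implicit Types (B C : set Omega) (J K T : pred I) (q : R).

(** When [Pr B] is positive, this says that conditionally on [B] the [E i] with [J i] are mutually
    independent with unchanged probabilities; the product form avoids dividing by [Pr B]. For
    [B = setT] it is plain mutual independence. *)
Definition independent_of B J : Prop :=
  [/\ measurable B, forall i, J i -> measurable (E i)
    & forall F : seq I, uniq F -> all J F ->
      Pr (B `&` \bigcap_(i in [set` F]) E i) =
      (Pr B * \prod_(i <- F) Pr (E i))%E].

(* C is an event of probability q that involves only the E i with i in T:
   conditioning on it multiplies the probability by q and preserves independence
   from the remaining E i. *)
Definition factor q T C : Prop :=
  forall J B, {subset T <= J} -> independent_of B J ->
    independent_of (B `&` C) [predD J & T] /\ Pr (B `&` C) = (Pr B * q%:E)%E.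

Lemma independent_of_sub B J K :
  {subset K <= J} -> independent_of B J -> independent_of B K.
Proof.
move=> KJ [mB mE indB]; split=> // [i /KJ/mE //|F uF /allP KF].
by apply: indB => //; apply/allP => i /KF/KJ.
Qed.

Lemma factor_sub q T T' C :
  {subset T <= T'} -> factor q T C -> factor q T' C.
Proof.
move=> TT' facC J B T'J indB.
have [|indBC ->] := facC J B _ indB; first by move=> i /TT'/T'J.
split=> //; apply: independent_of_sub indBC => i /andP[/= nT' Ji].
by apply/andP; split=> //=; apply: contra nT' => /TT'.
Qed.

(** Apply the product rule for [B] to [i :: F]; this list is duplicate-free because [i] has been
    removed from the index set containing [F]. *)
Lemma factor_event q i : Pr (E i) = q%:E -> factor q (pred1 i) (E i).
Proof.
move=> PrE J B iJ [mB mE indB].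
have Ji : J i by apply: iJ; exact/eqP.
have PrBE : Pr (B `&` E i) = (Pr B * q%:E)%E.
  have := indB [:: i] isT; rewrite /= Ji bigcap_seq !big_seq1 PrE; exact.
split=> //; split=> [|j /andP[_ /mE //]|F uF /allP JF].
  exact: measurableI (mE i Ji).
have iF : i \notin F by apply/negP => /JF /=; rewrite !inE eqxx.
have := indB (i :: F); rewrite /= iF uF Ji /= !bigcap_seq !big_cons PrE setIA PrBE.
move=> -> //; first by rewrite muleA.
by apply/allP => j /JF /andP[].
Qed.

(** Subtract the measure of the part inside [C], once from [B] and once from [B] intersected with
    finitely many remaining events. *)
Lemma factorC q T C : factor q T C -> factor (1 - q) T (~` C).
Proof.
move=> facC J B TJ indB; have [mB mE PrB] := indB.
have [[mBC _ PrBC] PrBCE] := facC J B TJ indB.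
have setDIC A : A `&` ~` C = A `\` (A `&` C).
  by rewrite setDE setCI setIUr setICr set0U.
have PrDC A : measurable A -> measurable (A `&` C) ->
    Pr (A `&` C) = (Pr A * q%:E)%E -> Pr (A `&` ~` C) = (Pr A * (1 - q)%:E)%E.
  move=> mA mAC PrAC; have finA : Pr A \is a fin_num by rewrite fin_num_measure.
  rewrite setDIC measureD //; last by rewrite ltey_eq finA.
  by rewrite setIA setIid EFinB muleBr // mule1; congr (_ - _)%E.
split; last exact: PrDC.
split=> [|i /andP[_ /mE //]|F uF JF]; first by rewrite setDIC; exact: measurableD.
have JF' : all J F by apply/allP => i /(allP JF)/andP[].
have mF : measurable (\bigcap_(i in [set` F]) E i).
  by rewrite bigcap_seq big_seq; apply: bigsetI_measurable => i /(allP JF')/mE.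
rewrite setIAC PrDC ?PrB //.
- by rewrite PrDC // -!muleA (muleC (1 - q)%:E).
- exact: measurableI.
- by rewrite setIAC; exact: measurableI.
- by rewrite setIAC PrBC // PrBCE -!muleA (muleC q%:E).
Qed.

(** Condition on the events one after the other: since the index sets [T x] are disjoint,
    conditioning on one leaves those of the others available. *)
Lemma factor_all (X : eqType) (T : X -> pred I) (C : X -> pred Omega) q s :
  uniq s -> {in s, forall x, factor q (T x) [set w | C x w]} ->
  {in s &, forall x y i, T x i -> T y i -> x = y} ->
  factor (q ^+ size s) (fun i => has (T^~ i) s) [set w | all (C^~ w) s].
Proof.
elim: s => [_ _ _|x s IHs /= /andP[xs us] facC disjT].
  move=> J B _ indB /=; rewrite (_ : [set w | _] = setT) ?setIT ?mule1; last first.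
    by apply/seteqP; split.
  by split=> //; apply: independent_of_sub indB => i /andP[].
move=> J B TJ indB.
have [|indBx Bx] := facC x (mem_head _ _) J B _ indB.
  by move=> i Txi; apply: TJ; apply/orP; left.
have fac_s : factor (q ^+ size s) (fun i => has (T^~ i) s) [set w | all (C^~ w) s].
  apply: IHs => // [y ys|y z ys zs]; first by apply: facC; rewrite inE ys orbT.
  by apply: disjT; rewrite inE ?ys ?zs orbT.
have [|indBxs Bxs] := fac_s _ _ _ indBx.
  move=> i /hasP[y ys Tyi]; apply/andP; split.
    apply/negP => /= Txi; move: xs; rewrite (disjT x y _ _ i) ?ys ?mem_head //.
    by rewrite inE ys orbT.
  by apply: TJ; apply/orP; right; apply/hasP; exists y.
rewrite (_ : [set w | _] = [set w | C x w] `&` [set w | all (C^~ w) s]); last first.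
  by apply/seteqP; split=> w /=; [move/andP | move=> h; apply/andP].
rewrite setIA; split; last by rewrite Bxs Bx -muleA exprS.
by apply: independent_of_sub indBxs => i; rewrite !inE negb_or -andbA; case/and3P=> -> -> ->.
Qed.

End Independence.

(** * Success and failure probabilities of the windows *)

Section Windows.
Local Open Scope classical_set_scope.
Context d (Omega : measurableType d) (R : realType) (Pr : probability Omega R).
Context (V : finType) (gph : rel V) (P0 : R) (Tth : nat).
Context (A : nat -> {set V} -> Omega -> bool).
Hypothesis Tth_gt0 : (0 < Tth)%N.
Hypothesis A_attempts : attempts Pr gph P0 A.

Let E (tf : nat * {set V}) : set Omega := [set w | A tf.1 tf.2 w].

Lemma path_edgesP s p : path gph s p -> all (is_edge gph) (path_edges s p).
Proof.
elim: p s => //= v p IHp s /andP[gsv gp]; rewrite IHp // andbT.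
by apply/existsP; exists s; apply/existsP; exists v; rewrite gsv eqxx.
Qed.

Lemma size_path_edges (s : V) p : size (path_edges s p) = size p.
Proof. exact: size_pairmap. Qed.

(** Complements of [Tth] distinct attempts. Describing the time steps of window [k] by a quotient
    makes the index sets of different windows visibly disjoint. *)
Lemma factor_failures k f : is_edge gph f ->
  factor Pr E ((1 - P0) ^+ Tth) [pred tf | (tf.1 %/ Tth == k)%N & tf.2 == f]
    [set w | all (fun i : 'I_Tth => ~~ A (k * Tth + i) f w) (enum 'I_Tth)].
Proof.
move=> gf; have [mA PrA _] := A_attempts.
rewrite -[X in _ ^+ X](size_enum_ord Tth).
pose T (i : 'I_Tth) : pred (nat * {set V}) := pred1 ((k * Tth + i)%N, f).
apply: (factor_sub (T := fun tf => has (T^~ tf) (enum 'I_Tth))).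
  move=> tf /hasP[i _ /eqP->]; rewrite inE /= eqxx andbT.
  by rewrite divnMDl // divn_small // addn0.
apply: factor_all => [|i _|i j _ _ tf /eqP-> /eqP[/addnI/val_inj//]].
  exact: enum_uniq.
have facA : factor Pr E P0 (T i) [set w | A (k * Tth + i) f w].
  by apply: (@factor_event _ _ _ Pr _ E P0 ((k * Tth + i)%N, f)); exact: PrA.
rewrite (_ : [set w | _] = ~` [set w | A (k * Tth + i) f w]); first exact: factorC.
by apply/seteqP; split=> w /= /negP.
Qed.

(* [undup] spares the proof that a shortest path repeats no edge: repetitions
   would only make success more likely. *)
Lemma factor_window k s p : path gph s p ->
  factor Pr E ((1 - (1 - P0) ^+ Tth) ^+ size (undup (path_edges s p)))
    [pred tf | (tf.1 %/ Tth == k)%N & tf.2 \in path_edges s p]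
    [set w | window_succeeds Tth A s p w k].
Proof.
move=> gp.
pose c f w := [exists i : 'I_Tth, A (k * Tth + i) f w].
pose T f : pred (nat * {set V}) := [pred tf | (tf.1 %/ Tth == k)%N & tf.2 == f].
have facc f : f \in undup (path_edges s p) ->
    factor Pr E (1 - (1 - P0) ^+ Tth) (T f) [set w | c f w].
  rewrite mem_undup => /(allP (path_edgesP gp)) gf.
  (* Edge [f] succeeds in the window exactly when its attempts do not all fail. *)
  rewrite (_ : [set w | _] = ~` [set w |
      all (fun i : 'I_Tth => ~~ A (k * Tth + i) f w) (enum 'I_Tth)]).
    by apply: factorC; exact: factor_failures.
  apply/seteqP; split=> w /=.
    by case/existsP => i Ai /allP/(_ i (mem_enum _ i)); rewrite Ai.
  move/negP; rewrite -has_predC => /hasP[i _ /negPn Ai].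
  by apply/existsP; exists i.
have := factor_all (undup_uniq _) facc.
rewrite (_ : [set w | all _ _] = [set w | window_succeeds Tth A s p w k]).
  move=> fac; apply: factor_sub (fac _) => [tf /hasP[f]|f f' _ _ tf].
    by rewrite mem_undup => fp /andP[tfk /eqP tff]; rewrite inE tfk tff.
  by move=> /andP[_ /eqP tff] /andP[_ /eqP]; rewrite tff.
by apply/seteqP; split=> w /=; rewrite all_undup.
Qed.

Lemma factor_no_window n s p : path gph s p ->
  factor Pr E
    ((1 - (1 - (1 - P0) ^+ Tth) ^+ size (undup (path_edges s p))) ^+ n)
    (is_edge gph \o snd)
    [set w | all (predC (window_succeeds Tth A s p w)) (iota 0 n)].
Proof.
move=> gp; rewrite -[X in _ ^+ X](size_iota 0 n).
pose T k : pred (nat * {set V}) :=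
  [pred tf | (tf.1 %/ Tth == k)%N & tf.2 \in path_edges s p].
apply: (factor_sub (T := fun tf => has (T^~ tf) (iota 0 n))).
  by move=> tf /hasP[k _] /andP[_] /= /(allP (path_edgesP gp)).
apply: (factor_all (C := fun k w => ~~ window_succeeds Tth A s p w k)).
- exact: iota_uniq.
- move=> k _; rewrite (_ : [set w | _] = ~` [set w | window_succeeds Tth A s p w k]).
    by apply: factorC; exact: factor_window.
  by apply/seteqP; split=> w /= /negP.
- by move=> k k' _ _ tf /andP[/eqP tfk _] /andP[/eqP]; rewrite tfk.
Qed.

Lemma no_window n s p : path gph s p ->
  let F := [set w | all (predC (window_succeeds Tth A s p w)) (iota 0 n)] in
  measurable F /\
  Pr F =
    ((1 - (1 - (1 - P0) ^+ Tth) ^+ size (undup (path_edges s p))) ^+ n)%:E.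
Proof.
move=> gp F; have [mA PrA indA] := A_attempts.
(* Conditioning starts from the sure event, for which the independence required is that of
   [attempts]. *)
have [|[mF _ _] PrF] := factor_no_window n gp (B := setT) (fun _ => id).
  split=> [|tf gtf|G uG allG]; first exact: measurableT.
    exact: mA.
  by rewrite setTI probability_setT mul1e indA.
by move: mF PrF; rewrite setTI probability_setT mul1e.
Qed.

End Windows.

Theorem lemma1 (R : realType) :
  exists2 Ccont : R, 0 < Ccont &
  forall Tth : nat, (0 < Tth)%N ->
  exists2 Cdem : R, 0 < Cdem &
  forall P0 : R, 0 < P0 -> P0 <= 1 ->
  let P : R := 1 - (1 - P0) ^+ Tth in
  forall (V : finType) (gph : rel V),
    simple_graph gph -> connected_graph gph ->
  forall D : V -> V -> nat, nb_demands D = 1%N ->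
  forall s e : V, D s e = 1%N ->
  forall alg : routing,
  forall (d : measure_display) (Omega : measurableType d)
         (Pr : probability Omega R),
    (forall (A : nat -> {set V} -> Omega -> bool) (p : seq V),
       attempts Pr gph P0 A -> shortest_path gph s e p ->
       (\int[Pr]_w on_demand_wait R Tth A s p w
          <= (Cdem * P ^- diameter gph)%:E)%E)
    /\
    (forall (dth cap : nat) (Ev : Omega -> rel V) (x : Omega -> nat -> V),
       (0 < dth)%N -> (0 < cap)%N ->
       random_virtual_graph gph dth Ev ->
       random_run gph alg cap Ev (D s e) s e x ->
       (\int[Pr]_w continuous_wait gph R e (x w)
          <= (Ccont * dth%:R * (diameter gph)%:R)%:E)%E).
Proof.
(* The factor 2 counts discovery and the way back; [Tth] is the length of one window. *)
exists 2 => // Tth Tth_gt0; exists Tth%:R; first by rewrite ltr0n.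
move=> P0 P0_gt0 P0_le1 P V gph [gsym girr] gconn D _ s e _ alg d Omega Pr.
split=> [A p attA [gp lastp sizep]|dth cap Ev x dth_gt0 _ [vEv _] [run _]].
  have r_ge0 : 0 <= 1 - P0 by rewrite subr_ge0.
  have r_lt1 : 1 - P0 < 1 by rewrite gtrBl.
  have P_gt0 : 0 < P by rewrite subr_gt0 exprn_ilt1 // -lt0n.
  have P_le1 : P <= 1 by rewrite gerBl exprn_ge0.
  pose q := P ^+ size (undup (path_edges s p)).
  have q_gt0 : 0 < q by rewrite exprn_gt0.
  have noW n := no_window Tth_gt0 attA n gp.
  apply: (@le_trans _ _ (Tth%:R / q)%:E).
    rewrite (_ : (fun w => on_demand_wait R Tth A s p w) = fun w =>
        if first_time (window_succeeds Tth A s p w) is Some k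
        then (k.+1%:R * Tth%:R)%:E else +oo%E); last first.
      apply/funext => w; rewrite /on_demand_wait.
      by case: first_time => // k; rewrite natrM.
    apply: expected_first_time_le => // [||n|n].
    - by rewrite ltr0n.
    - by rewrite exprn_ile1 // ltW.
    - by case: (noW n).
    - by case: (noW n).
  (* As [P <= 1], raising the exponent from the number of distinct edges to the diameter can only
     increase the inverse power. *)
  rewrite lee_fin ler_wpM2l // lef_pV2 ?posrE ?exprn_gt0 //.
  apply: ler_wiXn2l => //; first exact: ltW.
  apply: leq_trans (size_undup _) _; rewrite size_path_edges sizep.
  exact: hopdist_diameter.
apply: le_trans (ge0_le_integralT Pr _ (fun w =>
    continuous_wait_le gconn R dth_gt0 (vEv w) (run w))) _.
  by move=> w; rewrite /continuous_wait; case: first_time => // n; rewrite lee_fin.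
by rewrite integral_cst //= [X in (_ * X)%E]probability_setT mule1.
Qed.
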